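(* Let $a\in\mathbb{R}$, $c>0$, $\gamma\in(0,1]$. (i) Let $f\colon[0,1]^d\to\mathbb{R}$ be any $(c,\gamma)$-Hölder function with level set $\{f=a\}\ne\varnothing$. Then there exists $\kappa_1>0$ such that for every accuracy $\varepsilon>0$ ($\kappa_1$ being independent of $\varepsilon$) and all $n>\kappa_1/\varepsilon^{d/\gamma}$, the output $S_n$ returned by the BAH algorithm (run with input $a,c,\gamma$ on $f$) after the $n$-th query is an $\varepsilon$-approximation of $\{f=a\}$. (ii) There exists $\kappa_2>0$ (independent of $\varepsilon$) such that, for every $\varepsilon>0$, no deterministic algorithm can guarantee to output an $\varepsilon$-approximation of the level set $\{f=a\}$ for all $(c,\gamma)$-Hölder functions $f\colon[0,1]^d\to\mathbb{R}$ by querying less than $\kappa_2/\varepsilon^{d/\gamma}$ of their values; i.e., for every deterministic algorithm and every positive integer $n<\kappa_2/\varepsilon^{d/\gamma}$ there is a $(c,\gamma)$-Hölder function $f$ such that the output $S_n$ of the algorithm run on $f$ is not an $\varepsilon$-approximation of $\{f=a\}$.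
   Context: $d\ge1$ is an integer. $\{f=a\}:=\{x\in[0,1]^d: f(x)=a\}$. A set $S\subseteq[0,1]^d$ is an $\varepsilon$-approximation of $\{f=a\}$ if $\{f=a\}\subseteq S\subseteq\{x\in[0,1]^d:|f(x)-a|\le\varepsilon\}$. A function $f\colon[0,1]^d\to\mathbb{R}$ is $(c,\gamma)$-Hölder if $|f(x)-f(y)|\le c\,\|x-y\|_\infty^\gamma$ for all $x,y\in[0,1]^d$. Deterministic algorithm: a pair $(\varphi,\psi)$ of sequences of maps $\varphi_n\colon\mathbb{R}^{n-1}\to[0,1]^d$ and $\psi_n\colon\mathbb{R}^n\to\{\text{subsets of }[0,1]^d\}$, $n\ge1$; run on $f$, it queries $x_n=\varphi_n(f(x_1),\dots,f(x_{n-1}))$ and outputs $S_n=\psi_n(f(x_1),\dots,f(x_n))$. Bisection: for a family $\mathcal{C}$ of hypercubes in $[0,1]^d$, $\mathrm{bisect}(\mathcal{C})$ is the family obtained by subdividing each $[a_1,b_1]\times\cdots\times[a_d,b_d]\in\mathcal{C}$ into the $2^d$ hypercubes $I_1\times\cdots\times I_d$ with each $I_j$ equal to $[a_j,(a_j+b_j)/2]$ or $[(a_j+b_j)/2,b_j]$. BAH algorithm with input $(a,c,\gamma)$: initialize $\mathcal{C}_0=\{[0,1]^d\}$, $n=0$. For iterations $i=1,2,\dots$: set $S(i):=\bigcup_{C\in\mathcal{C}_{i-1}}C$ and $\mathcal{C}_i':=\mathrm{bisect}(\mathcal{C}_{i-1})$; for each $C'\in\mathcal{C}_i'$: increase $n$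 by $1$, query $x_n:=$ the center $c_{C'}$ of $C'$, observe $f(x_n)$, output $S_n:=S(i)$. Then set $\mathcal{C}_i:=\{C'\in\mathcal{C}_i':|f(c_{C'})-a|\le c\,2^{-\gamma i}\}$. *)

(* Defs.v *)
From mathcomp Require Import all_boot all_order all_algebra.
From mathcomp Require Import all_classical all_reals all_analysis.
Set Implicit Arguments.
Unset Strict Implicit.
Unset Printing Implicit Defensive.
Import Order.TTheory GRing.Theory Num.Theory.
Import numFieldNormedType.Exports.
Local Open Scope classical_set_scope.
Local Open Scope ring_scope.

Definition unit_cube (R : realType) (d : nat) : set 'rV[R]_d :=
  [set x | forall j, 0 <= x ord0 j <= 1].

(** A function on [0,1]^d is represented by a total function on ['rV[R]_d];
    no notion below looks at its values outside the cube.  The norm of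
    ['rV[R]_d] is the sup norm. *)
Definition holder (R : realType) (d : nat) (c g : R) (f : 'rV[R]_d -> R) :=
  forall x y, unit_cube x -> unit_cube y -> `|f x - f y| <= c * `|x - y| `^ g.

Definition level_set (R : realType) (d : nat) (f : 'rV[R]_d -> R) (a : R) :
    set 'rV[R]_d :=
  [set x | unit_cube x /\ f x = a].

Definition eps_approximation (R : realType) (d : nat) (f : 'rV[R]_d -> R)
    (a eps : R) (S : set 'rV[R]_d) :=
  level_set f a `<=` S /\ S `<=` [set x | unit_cube x /\ `|f x - a| <= eps].

(** [query A n] is the map choosing the (n+1)-st query from the first [n]
    observed values; [answer A n] is the map producing the output after [n]
    queries ([answer A 0], before any query, plays no role for n >= 1). *)
Record algorithm (R : realType) (d : nat) := Algorithm {
  query : forall n, n.-tuple R -> 'rV[R]_d;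
  answer : forall n, n.-tuple R -> set 'rV[R]_d;
  query_cube : forall n (v : n.-tuple R), unit_cube (query v);
  answer_cube : forall n (v : n.-tuple R), answer v `<=` @unit_cube R d }.

Fixpoint observed (R : realType) (d : nat) (A : algorithm R d)
    (f : 'rV[R]_d -> R) (n : nat) : n.-tuple R :=
  if n is m.+1 then
    let v := observed A f m in [tuple of rcons v (f (query A v))]
  else [tuple].

Definition algorithm_output (R : realType) (d : nat) (A : algorithm R d)
    (f : 'rV[R]_d -> R) (n : nat) : set 'rV[R]_d :=
  answer A (observed A f n).

(** The hypercube [a_1,b_1] x ... x [a_d,b_d] is encoded by its corners (a, b). *)
Notation cube R d := ('rV[R]_d * 'rV[R]_d)%type.

Definition cube_set (R : realType) (d : nat) (C : cube R d) : set 'rV[R]_d :=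
  [set x | forall j, C.1 ord0 j <= x ord0 j <= C.2 ord0 j].

Definition center (R : realType) (d : nat) (C : cube R d) : 'rV[R]_d :=
  2^-1 *: (C.1 + C.2).

(** [s j] selects the upper half of the j-th side. *)
Definition subcube (R : realType) (d : nat) (C : cube R d)
    (s : {ffun 'I_d -> bool}) : cube R d :=
  (\row_j (if s j then (C.1 ord0 j + C.2 ord0 j) / 2 else C.1 ord0 j),
   \row_j (if s j then C.2 ord0 j else (C.1 ord0 j + C.2 ord0 j) / 2)).

(** Finite families of cubes are lists; those produced from the unit cube by
    successive bisections and selections have no repetition. *)
Definition bisect (R : realType) (d : nat) (Cs : seq (cube R d)) :
    seq (cube R d) :=
  [seq subcube C s | C <- Cs, s <- enum {ffun 'I_d -> bool}].

Fixpoint bah_cubes (R : realType) (d : nat) (a c g : R) (f : 'rV[R]_d -> R)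
    (i : nat) : seq (cube R d) :=
  if i is j.+1 then
    [seq C <- bisect (bah_cubes a c g f j)
       | `|f (center C) - a| <= c * 2 `^ (- g * i%:R)]
  else [:: (const_mx 0, const_mx 1)].

Definition bah_region (R : realType) (d : nat) (a c g : R) (f : 'rV[R]_d -> R)
    (i : nat) : set 'rV[R]_d :=
  \bigcup_(C in [set` bah_cubes a c g f i.-1]) cube_set C.

(** Within iteration [i] the bisected cubes are visited in the arbitrary order
    [visit i]. *)
Definition visiting_order (R : realType) (d : nat)
    (visit : nat -> seq (cube R d) -> seq (cube R d)) :=
  forall i Cs, perm_eq (visit i Cs) Cs.

(** The pairs (x_n, S_n) produced during iterations 1, ..., m, in order. *)
Definition bah_trace (R : realType) (d : nat)
    (visit : nat -> seq (cube R d) -> seq (cube R d)) (a c g : R)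
    (f : 'rV[R]_d -> R) (m : nat) : seq ('rV[R]_d * set 'rV[R]_d) :=
  flatten [seq [seq (center C, bah_region a c g f i)
                 | C <- visit i (bisect (bah_cubes a c g f i.-1))]
            | i <- iota 1 m].

(** [Some S_n], or [None] if no n-th query is ever made.  An iteration that
    makes no query is followed only by such iterations, so the n-th query, if
    any, occurs within the first [n] iterations.  Meant for n >= 1. *)
Definition bah_output (R : realType) (d : nat)
    (visit : nat -> seq (cube R d) -> seq (cube R d)) (a c g : R)
    (f : 'rV[R]_d -> R) (n : nat) : option (set 'rV[R]_d) :=
  omap snd (onth (bah_trace visit a c g f n) n.-1).

(* Main.v *)
(** (i) Every kept or bisected cube is counted by the crude bound 2^(d i), so at
    most 2 * 2^(d i) queries are made by the end of iteration i, while on the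
    region output in iteration i the selection criterion and the Hölder
    condition give |f - a| <= 2 c 2^(- g (i - 1)) <= 4 c 2^(- g i).  Points of
    the level set are never discarded, so every iteration makes a query.

    (ii) Run the algorithm on the constant function a: unless this already
    defeats it, it outputs the whole cube.  A grid of more than n cells has a
    cell whose open interior was never queried; adding there the Hölder bump
    max 0 (c (r^g - |x - z|^g)), of height c r^g > eps, leaves the run, hence
    the output, unchanged. *)

Require Import Defs.
From mathcomp Require Import all_boot all_order all_algebra.
From mathcomp Require Import all_classical all_reals all_analysis.
From mathcomp Require Import lra zify.
Set Implicit Arguments.
Unset Strict Implicit.
Unset Printing Implicit Defensive.
Import Order.TTheory GRing.Theory Num.Theory.
Import numFieldNormedType.Exports.
Local Open Scope classical_set_scope.
Local Open Scope ring_scope.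

(** * The sup norm and its powers with exponent at most 1 *)

Section SupNorm.
Variables (R : realType) (d : nat).
Implicit Types x : 'rV[R]_d.

Lemma rV_norm_le x r : 0 <= r -> (forall j, `|x ord0 j| <= r) -> `|x| <= r.
Proof.
move=> r0 xr; rewrite /Num.norm/= mx_normrE; apply/bigmax_le => //=.
by case=> i j _ /=; rewrite (ord1 i).
Qed.

Lemma rV_norm_ge x j : `|x ord0 j| <= `|x|.
Proof.
rewrite {2}/Num.norm/= mx_normrE.
exact: (le_bigmax _ (fun ij : 'I_1 * 'I_d => `|x ij.1 ij.2|) (ord0, j)).
Qed.

End SupNorm.

Lemma powRVl (R : realType) (x r : R) : 0 <= x -> x^-1 `^ r = (x `^ r)^-1.
Proof. by move=> x0; rewrite -powR_inv1// powRAC powR_inv1 ?powR_ge0. Qed.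

(** With s = x + y, the ratios x/s and y/s lie in [0,1] and hence are at most their [g]-th powers;
    they sum to 1, so multiplying by s^g gives the claim. *)
Lemma powR_subadditive (R : realType) (g x y : R) :
  g <= 1 -> 0 <= x -> 0 <= y -> (x + y) `^ g <= x `^ g + y `^ g.
Proof.
move=> g1; rewrite le_eqVlt => /predU1P[<-|x0]; first by rewrite add0r lerDr powR_ge0.
rewrite le_eqVlt => /predU1P[<-|y0]; first by rewrite addr0 lerDl powR_ge0.
have s0 : 0 < x + y by rewrite addr_gt0.
have sub z : 0 < z -> z <= x + y -> (x + y) `^ g * (z / (x + y)) <= z `^ g.
  move=> z0 zs; have {2}-> : z = (x + y) * (z / (x + y)).
    by rewrite mulrC divfK// gt_eqF.
  rewrite powRM ?divr_ge0 ?(ltW s0) ?(ltW z0)// ler_wpM2l ?powR_ge0//.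
  by rewrite ger1_powR// divr_gt0//= ler_pdivrMr// mul1r.
apply: le_trans (lerD (sub x x0 _) (sub y y0 _)); last 2 first.
- by rewrite lerDl ltW.
- by rewrite lerDr ltW.
by rewrite -mulrDr -mulrDl divff ?mulr1// gt_eqF.
Qed.

Lemma powR_dist (R : realType) (d : nat) (g : R) (u v : 'rV[R]_d) :
  0 <= g -> g <= 1 -> `| `|u| `^ g - `|v| `^ g | <= `|u - v| `^ g.
Proof.
move=> g0 g1.
have H (w z : 'rV[R]_d) : `|w| `^ g - `|z| `^ g <= `|w - z| `^ g.
  rewrite lerBlDr; apply: le_trans (powR_subadditive _ _ _) => //.
  rewrite ge0_ler_powR ?nnegrE ?addr_ge0//.
  by rewrite -[leLHS](congr1 Num.norm (subrK z w)) ler_normD.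
by rewrite ler_norml H andbT lerNl opprB distrC H.
Qed.

Local Notation center := Defs.center.

(** * Geometry of the kept cubes *)

Section Bisection.
Variables (R : realType) (d : nat).
Implicit Types (C : cube R d) (x : 'rV[R]_d) (f : 'rV[R]_d -> R).

Definition dyadic_cube (i : nat) C := forall j,
  [/\ 0 <= C.1 ord0 j, C.2 ord0 j <= 1 & C.2 ord0 j = C.1 ord0 j + 2 ^- i].

Lemma dyadic_subcube i C s : dyadic_cube i C -> dyadic_cube i.+1 (subcube C s).
Proof.
move=> HC j; have [l u e] := HC j; rewrite !mxE e.
have p : 0 < (2 : R) ^- i by rewrite invr_gt0 exprn_gt0.
have -> : (2 : R) ^- i.+1 = 2 ^- i / 2 by rewrite exprS invfM mulrC.
by rewrite e in u; case: (s j); split; lra.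
Qed.

Lemma dyadic_cube_unit i C x : dyadic_cube i C -> cube_set C x -> unit_cube x.
Proof. by move=> HC xC j; have [? ? _] := HC j; have := xC j; lra. Qed.

Lemma dyadic_cube_center i C : dyadic_cube i C -> cube_set C (center C).
Proof.
move=> HC j; have [_ _ e] := HC j; rewrite !mxE e.
have p : 0 < (2 : R) ^- i by rewrite invr_gt0 exprn_gt0.
by apply/andP; split; lra.
Qed.

(** Half of this bound is the true one; the full side is what matches the selection threshold c
    (2^-i)^g. *)
Lemma dyadic_cube_dist i C x :
  dyadic_cube i C -> cube_set C x -> `|x - center C| <= 2 ^- i.
Proof.
have p : 0 < (2 : R) ^- i by rewrite invr_gt0 exprn_gt0.
move=> HC xC; apply: rV_norm_le => [|j]; first exact: ltW.
have [_ _ e] := HC j; have := xC j; rewrite !mxE e => /andP[? ?].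
by rewrite ler_norml; apply/andP; split; lra.
Qed.

Lemma subcube_cover C x : cube_set C x -> exists s, cube_set (subcube C s) x.
Proof.
move=> xC; exists [ffun j => (C.1 ord0 j + C.2 ord0 j) / 2 <= x ord0 j] => j.
rewrite !mxE !ffunE; have := xC j.
by case: (leP (_ / 2)) => /= [-> /andP[_ ->]|/ltW -> /andP[->]].
Qed.

Variables (a c g : R).
Hypotheses (c_gt0 : 0 < c) (g_gt0 : 0 < g).

Lemma bah_threshold i : c * 2 `^ (- g * i%:R) = c * (2 ^- i) `^ g.
Proof. by rewrite mulNr -mulrN mulrC [X in 2 `^ X]mulrC powRrM powR_invn// mulrC. Qed.

Lemma bah_cubes_dyadic f i C : C \in bah_cubes a c g f i -> dyadic_cube i C.
Proof.
elim: i C => [|i IH] C /=.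
  by rewrite inE => /eqP-> j; rewrite !mxE expr0 invr1; split; lra.
rewrite mem_filter => /andP[_ /allpairsP[[D s] /= [/IH HD _ ->]]].
exact: dyadic_subcube.
Qed.

Lemma bah_cubes_dist f i C x : holder c g f -> C \in bah_cubes a c g f i ->
  cube_set C x -> `|f x - f (center C)| <= c * (2 ^- i) `^ g.
Proof.
move=> Hf /bah_cubes_dyadic HC xC.
have xu := dyadic_cube_unit HC xC.
have cu := dyadic_cube_unit HC (dyadic_cube_center HC).
apply: le_trans (Hf _ _ xu cu) _; rewrite ler_pM2l//.
by rewrite ge0_ler_powR ?nnegrE ?invr_ge0 ?exprn_ge0 ?(ltW g_gt0)//
  (dyadic_cube_dist HC).
Qed.

(** A subcube containing [x] survives the selection: by the Hölder condition its center has a value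
    within the threshold of f(x) = a. *)
Lemma bah_cubes_cover f i x : holder c g f -> level_set f a x ->
  exists2 C, C \in bah_cubes a c g f i & cube_set C x.
Proof.
move=> Hf [xu fx]; elim: i => [|i [C CC xC]].
  exists (const_mx 0, const_mx 1); first by rewrite inE.
  by move=> j; rewrite !mxE.
have [s xs] := subcube_cover xC.
exists (subcube C s) => //=; rewrite mem_filter; apply/andP; split; last first.
  by apply: allpairs_f => //; rewrite mem_enum.
have HC := dyadic_subcube s (bah_cubes_dyadic CC).
have cu := dyadic_cube_unit HC (dyadic_cube_center HC).
rewrite bah_threshold -fx distrC; apply: le_trans (Hf _ _ xu cu) _.
rewrite ler_pM2l//.
by rewrite ge0_ler_powR ?nnegrE ?invr_ge0 ?exprn_ge0 ?(ltW g_gt0)//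
  (dyadic_cube_dist HC).
Qed.

Lemma size_bisect (Cs : seq (cube R d)) :
  size (bisect Cs) = (size Cs * 2 ^ d)%N.
Proof. by rewrite size_allpairs -cardE card_ffun card_bool card_ord. Qed.

Lemma size_bah_cubes f i : (size (bah_cubes a c g f i) <= 2 ^ (d * i))%N.
Proof.
elim: i => [|i IH]; first by rewrite muln0.
rewrite /= size_filter; apply: leq_trans (count_size _ _) _.
by rewrite size_bisect mulnS addnC expnD leq_mul2r IH orbT.
Qed.

(* The unit cube has not been selected by its center: in iteration 1 the bound
   comes from the nonempty level set instead. *)
Lemma bah_region_dist f i x : holder c g f -> level_set f a !=set0 ->
  bah_region a c g f i.+1 x -> `|f x - a| <= 2 * (c * (2 ^- i) `^ g).
Proof.
move=> Hf [y [yu fy]] [C /= CC xC].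
have p : 0 <= c * (2 ^- i) `^ g by rewrite mulr_ge0 ?ltW ?powR_ge0.
have dC z := @bah_cubes_dist f i C z Hf CC.
case: i CC p dC => [CC p dC|i CC p dC].
  have yC : cube_set C y by move: CC; rewrite inE => /eqP-> j; rewrite !mxE; exact: yu.
  have := dC _ xC; have := dC _ yC; rewrite fy !ler_norml => /andP[? ?] /andP[? ?].
  by apply/andP; split; lra.
have := dC _ xC; move: CC; rewrite /= mem_filter => /andP[+ _].
rewrite bah_threshold !ler_norml => /andP[? ?] /andP[? ?].
by apply/andP; split; lra.
Qed.

Lemma bah_region_unit f i : bah_region a c g f i `<=` @unit_cube R d.
Proof. by move=> x [C /= /bah_cubes_dyadic HC]; exact: dyadic_cube_unit. Qed.

(** * Counting the queries *)

Section Trace.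
Variables (visit : nat -> seq (cube R d) -> seq (cube R d)) (f : 'rV[R]_d -> R).
Hypothesis visitP : visiting_order visit.

Lemma bah_traceS m : bah_trace visit a c g f m.+1 = bah_trace visit a c g f m ++
  [seq (center C, bah_region a c g f m.+1)
     | C <- visit m.+1 (bisect (bah_cubes a c g f m))].
Proof.
by rewrite /bah_trace -[X in iota _ X]addn1 iotaD map_cat flatten_cat /= cats0.
Qed.

Lemma size_bah_trace m : size (bah_trace visit a c g f m) =
  (\sum_(i < m) size (bah_cubes a c g f i) * 2 ^ d)%N.
Proof.
elim: m => [|m IH]; first by rewrite big_ord0.
rewrite bah_traceS size_cat IH size_map (perm_size (visitP _ _)).
by rewrite size_bisect big_ord_recr.
Qed.

Lemma size_bah_trace_le m : (0 < d)%N ->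
  (size (bah_trace visit a c g f m) <= 2 * 2 ^ (d * m))%N.
Proof.
move=> d0; rewrite size_bah_trace; elim: m => [|m IH]; first by rewrite big_ord0.
(* This absorbs the factor 2: all earlier queries number at most 2 * 2^(dm) <= 2^(d(m+1)), and the
   new iteration adds at most as many again. *)
have d2 : (2 <= 2 ^ d)%N by rewrite -{1}(expn1 2) leq_exp2l.
rewrite big_ord_recr /= mulnS expnD mulnA mul2n -addnn mulnDl leq_add//.
  by apply: leq_trans IH _; rewrite leq_mul2r d2 orbT.
by rewrite mulnC leq_mul2l size_bah_cubes orbT.
Qed.

(** Attributes an entry to its iteration i+1; the size inequality turns a large query index into a
    large [i]. *)
Lemma onth_bah_trace m k p : onth (bah_trace visit a c g f m) k = Some p ->
  exists2 i, p.2 = bah_region a c g f i.+1 &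
    (k < size (bah_trace visit a c g f i.+1))%N.
Proof.
elim: m => [|m IH]; first by rewrite onth0n.
rewrite bah_traceS onth_cat; case: ifP => [_ /IH //|km].
set s := map _ _ => E; exists m.
  by move: E; rewrite onth_map; case: onth => //= C [<-].
rewrite bah_traceS size_cat -/s.
have : onth s (k - size (bah_trace visit a c g f m)) by rewrite E.
by rewrite onthTE; move/negbT: km; lia.
Qed.

(** A point of the level set keeps every family nonempty, so each iteration makes at least one
    query. *)
Lemma leq_size_bah_trace m : holder c g f -> level_set f a !=set0 ->
  (m <= size (bah_trace visit a c g f m))%N.
Proof.
move=> Hf [x fx]; rewrite size_bah_trace -{1}[m]card_ord -sum1_card.
apply: leq_sum => i _; rewrite muln_gt0 expn_gt0 andbT.
by have [C + _] := bah_cubes_cover i Hf fx; case: bah_cubes.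
Qed.

End Trace.

(** * The upper bound *)

Lemma bah_upper_bound visit f : (0 < d)%N -> g <= 1 ->
  visiting_order visit -> holder c g f -> level_set f a !=set0 ->
  forall eps n, 0 < eps -> 2 * (4 * c) `^ (d%:R / g) / eps `^ (d%:R / g) < n%:R ->
  exists2 S, bah_output visit a c g f n = Some S & eps_approximation f a eps S.
Proof.
move=> d0 g1 visitP Hf f0 eps n e0 hn.
have n0 : (0 < n)%N.
  rewrite -(ltr_nat R); apply: le_lt_trans hn.
  by rewrite divr_ge0 ?mulr_ge0 ?powR_ge0.
have : onth (bah_trace visit a c g f n) n.-1.
  by rewrite onthTE prednK// leq_size_bah_trace.
rewrite /bah_output; case E : onth => [p|//] _.
have [i pS] := onth_bah_trace E.
(* Query [n] is made by the end of iteration i+1, hence n <= 2 * 2^(d(i+1)), which is 2 h^d for the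
   [h] below. *)
rewrite prednK// => /leq_trans/(_ (size_bah_trace_le _ visitP _ d0)) ni.
exists p.2 => //; rewrite pS; split=> x.
  by move=> /(bah_cubes_cover i Hf)[C CC xC]; exists C.
move=> xS; split; first exact: bah_region_unit xS.
apply: le_trans (bah_region_dist Hf f0 xS) _.
set h := (2 : R) ^+ i.+1.
have h0 : 0 < h by rewrite exprn_gt0.
(* Since 2^-i = 2/h and 2^g <= 2, the error 2c (2^-i)^g is at most 4c / h^g. *)
suff H : 4 * c / eps < h `^ g.
  have hg0 : 0 < h `^ g by rewrite powR_gt0.
  have -> : (2 : R) ^- i = 2 * h^-1.
    by rewrite /h exprS invfM mulrA divff ?mul1r// pnatr_eq0.
  rewrite powRM ?invr_ge0 ?(ltW h0)// powRVl ?(ltW h0)//.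
  have : c * 2 `^ g <= c * 2 by rewrite ler_pM2l// ler1_powR// ler1n.
  by rewrite !mulrA ler_pdivrMr//; move: H; rewrite ltr_pdivrMr//; lra.
(* Otherwise raising to the power d/g gives h^d <= (4c/eps)^(d/g), so n <= 2 h^d contradicts the
   assumed size of [n]. *)
rewrite ltNge; apply/negP => H.
have dg : 0 < d%:R / g by rewrite divr_gt0// ltr0n.
have : (h `^ g) `^ (d%:R / g) <= (4 * c / eps) `^ (d%:R / g).
  apply: ge0_ler_powR => //; rewrite ?nnegrE ?powR_ge0 ?(ltW dg)//.
  by rewrite divr_ge0 ?mulr_ge0 ?(ltW c_gt0) ?(ltW e0).
rewrite -powRrM mulrC divfK ?gt_eqF// powR_mulrn ?(ltW h0)//.
rewrite powRM ?invr_ge0 ?mulr_ge0 ?(ltW c_gt0) ?(ltW e0)// powRVl ?(ltW e0)//.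
move=> H1; move: hn; rewrite -mulrA ltNge => /negP; apply.
apply: le_trans (_ : 2 * h ^+ d <= _); last by rewrite ler_pM2l.
by rewrite /h -exprM mulnC -natrX -natrM ler_nat.
Qed.

End Bisection.

(** * The lower bound by an adversary argument *)

Section LowerBound.
Variables (R : realType) (d : nat).

(** Queries depend only on values already seen, so comparing the functions along the run on [f]
    alone suffices, by induction. *)
Lemma observed_eq (A : algorithm R d) (f f' : 'rV[R]_d -> R) n :
  (forall k, (k < n)%N ->
     f' (query A (observed A f k)) = f (query A (observed A f k))) ->
  observed A f' n = observed A f n.
Proof.
elim: n => [//|n IH] H /=.
by rewrite IH => [|k kn]; [rewrite H|apply: H; exact: leqW].
Qed.

(** Centers of the m^d cells of side 1/m tiling the unit cube. *)
Definition grid_center m (k : {ffun 'I_d -> 'I_m}) : 'rV[R]_d :=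
  \row_j (((k j)%:R + 2^-1) / m%:R).

Lemma grid_center_unit m k : unit_cube (@grid_center m k).
Proof.
move=> j; rewrite mxE; have := ltn_ord (k j).
have m0 : (0 < m)%N by apply: leq_trans (ltn_ord (k j)).
rewrite -(ltr_nat R) => km; rewrite divr_ge0 ?addr_ge0//=.
rewrite ler_pdivrMr ?ltr0n// mul1r.
have : ((k j).+1%:R : R) <= m%:R by rewrite ler_nat.
by rewrite -natr1; lra.
Qed.

Lemma grid_center_sep m (k l : {ffun 'I_d -> 'I_m}) (x : 'rV[R]_d) :
  `|x - grid_center k| < (2 * m%:R)^-1 ->
  `|x - grid_center l| < (2 * m%:R)^-1 -> k = l.
Proof.
move=> xk xl; apply/ffunP => j; apply/val_inj/eqP => /=.
have m0 : (0 : R) < m%:R.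
  by rewrite ltr0n; apply: leq_trans (ltn_ord (k j)).
(* Scaled by [m], the j-th coordinate lies strictly between k'_j and k'_j + 1, which determines the
   integer k'_j. *)
have dist (k' : {ffun 'I_d -> 'I_m}) : `|x - grid_center k'| < (2 * m%:R)^-1 ->
    `|x ord0 j * m%:R - (k' j)%:R - 2^-1| < 2^-1.
  move=> /(le_lt_trans (rV_norm_ge _ j)); rewrite !mxE invfM.
  rewrite -[X in _ < X * _]mul1r -(ltr_pM2r m0) divfK ?gt_eqF// mul1r.
  rewrite -{2}(ger0_norm (ltW m0)) -normrM mulrBl divfK ?gt_eqF//.
  by rewrite opprD addrA.
move: (dist _ xk) (dist _ xl); rewrite !ltr_norml => /andP[? ?] /andP[? ?].
rewrite eqn_leq -(ltnS (k j)) -(ltnS (l j)) -!(ltr_nat R) -!natr1.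
by apply/andP; split; lra.
Qed.

(** Pigeonhole: if every cell interior contained a query, choosing one per cell would inject m^d
    cells into [n] queries, as the interiors are disjoint. *)
Lemma grid_center_avoid m n (q : 'I_n -> 'rV[R]_d) : (n < m ^ d)%N ->
  exists k : {ffun 'I_d -> 'I_m},
    forall i, (2 * m%:R)^-1 <= `|q i - grid_center k|.
Proof.
move=> nm; apply: contrapT => /forallNP H.
have {}H (k : {ffun 'I_d -> 'I_m}) : exists i, `|q i - grid_center k| < (2 * m%:R)^-1.
  apply: contrapT => /forallNP Hk; apply: (H k) => i.
  by rewrite leNgt; apply/negP/Hk.
have [h Hh] := choice H.
have /leq_card : injective h.
  by move=> k l kl; apply: (@grid_center_sep _ _ _ (q (h k))); rewrite ?Hh// kl.
by rewrite card_ffun !card_ord leqNgt nm.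
Qed.

Definition bump (a c g r : R) (z x : 'rV[R]_d) : R :=
  a + Num.max 0 (c * (r `^ g - `|x - z| `^ g)).

(** The untruncated profile is Hölder by [powR_dist], and t -> max 0 t is 1-Lipschitz. *)
Lemma holder_bump a c g r z : 0 <= c -> 0 <= g -> g <= 1 ->
  holder c g (bump a c g r z).
Proof.
move=> c0 g0 g1 x y _ _; rewrite /bump opprD addrACA subrr add0r.
have H : `|c * (r `^ g - `|x - z| `^ g) - c * (r `^ g - `|y - z| `^ g)|
         <= c * `|x - y| `^ g.
  rewrite -mulrBr opprB addrC addrA subrK normrM (ger0_norm c0) ler_wpM2l//.
  by rewrite distrC (le_trans (powR_dist _ _ _ _))// opprB addrA subrK.
apply: le_trans H.
set u := c * (_ - `|x - z| `^ g); set v := c * _; rewrite !maxEle.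
by rewrite ler_norml; case: (leP 0 u) => /= ?; case: (leP 0 v) => /= ?;
  case: (ler0P (u - v)) => ?; apply/andP; split; lra.
Qed.

Lemma no_eps_approximation (a c g eps : R) (A : algorithm R d) (m n : nat) :
  0 <= c -> 0 < g -> g <= 1 -> (n < m ^ d)%N ->
  eps < c * ((2 * m%:R)^-1) `^ g ->
  exists2 f : 'rV[R]_d -> R,
    holder c g f & ~ eps_approximation f a eps (algorithm_output A f n).
Proof.
move=> c0 g0 g1 nm epsm; set r := (2 * m%:R)^-1 in epsm.
pose f0 (_ : 'rV[R]_d) := a.
have [full|notfull] := pselect (@unit_cube R d `<=` algorithm_output A f0 n); last first.
  exists f0 => [x y _ _|[S _]]; first by rewrite subrr normr0 mulr_ge0 ?powR_ge0.
  by apply: notfull => x xu; apply: S.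
have [k Hk] := grid_center_avoid (fun i => query A (observed A f0 i)) nm.
set z := grid_center k in Hk.
exists (bump a c g r z); first by apply: holder_bump => //; exact: ltW.
have -> : algorithm_output A (bump a c g r z) n = algorithm_output A f0 n.
  (* Every query is at distance at least [r] from [z], where the truncation makes the bump equal to
     [a]. *)
  rewrite /algorithm_output (@observed_eq A f0)// => i ni.
  rewrite /bump /f0; apply/eqP; rewrite -subr_eq0 addrC addKr max_l//.
  rewrite mulr_ge0_le0// subr_le0 ge0_ler_powR ?nnegrE ?(ltW g0) ?invr_ge0 ?mulr_ge0//.
  exact: (Hk (Ordinal ni)).
(* The unchanged output contains [z], where the bump exceeds [a] by c r^g > eps. *)
move=> [_ /(_ z (full z (grid_center_unit k)))[_]].
rewrite /bump addrC addKr subrr normr0 powR0 ?gt_eqF// subr0.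
by move=> /(le_trans (ler_norm _)); rewrite ge_max => /andP[_]; rewrite leNgt epsm.
Qed.

Lemma algorithm_lower_bound (a c g eps : R) (A : algorithm R d) (n : nat) :
  (0 < d)%N -> 0 < c -> 0 < g -> g <= 1 -> 0 < eps -> (0 < n)%N ->
  n%:R < (c `^ g^-1 / 4) ^+ d / eps `^ (d%:R / g) ->
  exists2 f : 'rV[R]_d -> R,
    holder c g f & ~ eps_approximation f a eps (algorithm_output A f n).
Proof.
move=> d0 c0 g0 g1 e0 n0.
(* [X] solves c X^-g = eps, so a bump of radius 1/(2m) is higher than [eps] as soon as 2m < X. *)
pose X := (c / eps) `^ g^-1.
have X0 : 0 < X by rewrite powR_gt0// divr_gt0.
have -> : (c `^ g^-1 / 4) ^+ d / eps `^ (d%:R / g) = (X / 4) ^+ d.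
  rewrite /X powRM ?invr_ge0 ?(ltW c0) ?(ltW e0)// powRVl ?(ltW e0)//.
  by rewrite [d%:R / g]mulrC powRrM powR_mulrn ?powR_ge0// -exprVn -exprMn mulrAC.
move=> hn.
(* If X/4 <= 1, the bound n < (X/4)^d would leave no positive [n]. *)
have X4 : 1 < X / 4.
  rewrite ltNge; apply/negP => X1; move: hn; rewrite ltNge => /negP; apply.
  by apply: le_trans (_ : 1 <= _); rewrite ?ler1n// exprn_ile1// divr_ge0// ltW.
have /andP[tl tu] := truncn_itv (ltW (lt_trans ltr01 X4)).
(* Then m > X/4 gives n < m^d, while m <= X/4 + 1 < X/2 because X > 4. *)
set m := (Num.truncn (X / 4)).+1 in tu.
have mX : 2 * m%:R < X by rewrite /m -natr1; lra.
have m0 : (0 : R) < m%:R by rewrite ltr0n.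
apply: (@no_eps_approximation a c g eps A m n) => //; first exact: ltW.
  rewrite -(ltr_nat R) natrX; apply: lt_le_trans hn _.
  by rewrite lerXn2r ?nnegrE ?divr_ge0 ?ltW.
have : X^-1 `^ g < (2 * m%:R)^-1 `^ g.
  rewrite gt0_ltr_powR ?nnegrE ?invr_ge0 ?mulr_ge0 ?(ltW X0)//.
  by rewrite ltf_pV2 ?posrE ?mulr_gt0.
rewrite -(ltr_pM2l c0); apply: le_lt_trans.
rewrite powRVl ?(ltW X0)// /X -powRrM mulVf ?gt_eqF//.
by rewrite powRr1 ?divr_ge0 ?(ltW c0) ?(ltW e0)// invf_div mulrC divfK// gt_eqF.
Qed.

End LowerBound.

Unset Implicit Arguments.

Theorem theorem3 (R : realType) (d : nat) (d_ge1 : (1 <= d)%N) (a c g : R)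
    (c_gt0 : 0 < c) (g_gt0 : 0 < g) (g_le1 : g <= 1) :
  (forall (visit : nat -> seq (cube R d) -> seq (cube R d)),
     visiting_order visit ->
   forall f : 'rV[R]_d -> R, holder c g f -> level_set f a !=set0 ->
   exists2 kappa1 : R, 0 < kappa1 &
     forall eps : R, 0 < eps ->
     forall n : nat, kappa1 / eps `^ (d%:R / g) < n%:R ->
     exists2 S : set 'rV[R]_d,
       bah_output visit a c g f n = Some S & eps_approximation f a eps S)
  /\
  (exists2 kappa2 : R, 0 < kappa2 &
     forall eps : R, 0 < eps ->
     forall (A : algorithm R d) (n : nat),
       (0 < n)%N -> n%:R < kappa2 / eps `^ (d%:R / g) ->
     exists2 f : 'rV[R]_d -> R,
       holder c g f & ~ eps_approximation f a eps (algorithm_output A f n)).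
Proof.
split=> [visit visitP f Hf f0|].
  exists (2 * (4 * c) `^ (d%:R / g)) => [|eps e0 n].
    by rewrite mulr_gt0// powR_gt0// mulr_gt0.
  exact: bah_upper_bound.
exists ((c `^ g^-1 / 4) ^+ d) => [|eps e0 A n].
  by rewrite exprn_gt0// divr_gt0// powR_gt0.
exact: algorithm_lower_bound.
Qed.
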